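(* For each pair $(n,k)$ with (1) $n=4$ and $k\in\{4,6,8,10\}$, or (2) $n=5$ and $k\in\{4,16,18,20,22,24,26\}$, or (3) $n=6$ and $k=54$, or (4) $n=7$ and $k=114$, there exists a $k$-regular closed XOR-magic graph of power $n$.
   Context: All graphs are simple; a graph is $k$-regular if every vertex has exactly $k$ neighbours. For a vertex $x$, $N[x]$ is the set consisting of $x$ and its neighbours. A simple connected graph $G=(V,E)$ with $|V|=2^n$ is a closed XOR-magic graph of power $n$ if there is a bijection $\ell:V\to(\mathbb{Z}_2)^n$ such that $\sum_{y\in N[x]}\ell(y)$ is the zero vector of $(\mathbb{Z}_2)^n$ for every $x\in V$. *)

(* Defs.v *)
From mathcomp Require Import all_boot all_algebra.

Set Implicit Arguments.
Unset Strict Implicit.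
Unset Printing Implicit Defensive.

Local Open Scope ring_scope.

Section XorMagic.

Variable V : finType.
Implicit Type e : rel V.

Definition simple_graph e : Prop := symmetric e /\ irreflexive e.

Definition connected_graph e : Prop := forall x y : V, connect e x y.

Definition neighbours e (x : V) : {set V} := [set y | e x y].

Definition closed_neighbourhood e (x : V) : {set V} := x |: neighbours e x.

Definition regular_graph (k : nat) e : Prop :=
  forall x : V, #|neighbours e x| = k.

Definition closed_xor_magic (n : nat) e : Prop :=
  [/\ simple_graph e,
      connected_graph e,
      #|V| = (2 ^ n)%N &
      exists l : V -> 'rV['F_2]_n,
        bijective l /\
        forall x : V, \sum_(y in closed_neighbourhood e x) l y = 0].

End XorMagic.

(* Main.v *)
Require Import Defs.
From mathcomp Require Import all_boot all_algebra.

Set Implicit Arguments.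
Unset Strict Implicit.
Unset Printing Implicit Defensive.

Import GRing.Theory.

(** Let the vertices be the labels themselves, [x : 'rV['F_2]_n], and describe a
    graph by the set [S x] of directions in which the edges leave [x].  Suppose
    every [S x] has [d] elements whose sum is [x].  The neighbours [x + v] of [x]
    then sum to [d x + x].  If [d] is even, adding the label [x] gives zero.  If
    [d] is odd, the neighbours already sum to zero, hence so does their complement,
    which is the closed neighbourhood of [x] in the complementary graph: that
    graph is regular of degree [2 ^ n - 1 - d], and connected when [2 d < 2 ^ n].

    Seven such direction systems are given by tables.  The other ones come from
    two operations: adjoining to all the [S x] a fixed set of an even number of
    unused directions with sum zero, and passing from [(n, d)] to
    [(n + 2, d + 3)] by writing the identity of [F_2 ^ 2] as the sum of its three
    nilpotent matrices of rank one. *)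

(** * Graphs on [F_2 ^ n] given by directions, and their complements *)

Section DirectionSystem.

Variables n d : nat.
Let W := 'rV['F_2]_n.
Variable S : W -> {set W}.

(** The first clause makes adjacency symmetric: an edge leaving [x] along [v] leaves [x + v] along
    [v] too. *)
Definition direction_system : Prop :=
  [/\ forall x v, v \in S x -> v \in S (x + v)%R,
      forall x, 0%R \notin S x,
      forall x, #|S x| = d &
      forall x, (\sum_(v in S x) v = x)%R].

Definition direction_graph : rel W := fun x y => (x + y)%R \in S x.

Definition direction_cograph : rel W :=
  fun x y => (x != y) && ~~ direction_graph x y.

Local Open Scope ring_scope.

Lemma addvv (x : W) : x + x = 0.
Proof. by apply/matrixP=> i j; rewrite !mxE -mulr2n -mulr_natr pchar_Fp_0 ?mulr0. Qed.

Lemma addKv (x : W) : involutive (+%R x).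
Proof. by move=> y; rewrite addrA addvv add0r. Qed.

Lemma mulvn_odd (x : W) m : x *+ m = if odd m then x else 0.
Proof.
by elim: m => // m IHm; rewrite mulrS IHm /=; case: (odd m); rewrite ?addvv ?addr0.
Qed.

Lemma sum_row_F2 : (1 < n)%N -> \sum_(x : W) x = 0.
Proof.
move=> n_gt1; apply/rowP=> i; rewrite mxE.
have [j ji] : exists j : 'I_n, j != i.
  exists (if val i == 0%N then Ordinal n_gt1 else Ordinal (ltnW n_gt1)).
  by case: ifP => [/eqP i0|/negbT i0]; rewrite -val_eqE /= ?i0 // eq_sym.
(* The transvections [x |-> x + x_i e_j] permute the vectors. *)
pose f (x : W) : W := x + x 0 i *: delta_mx 0 j.
have fK : involutive f.
  move=> x; rewrite /f !mxE eqxx /= eq_sym (negPf ji) mulr0 addr0.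
  by rewrite -addrA addvv addr0.
have : \sum_(x : W) f x = \sum_(x : W) x by rewrite [RHS](reindex_inj (inv_inj fK)).
(* Cancelling leaves [(\sum_x x 0 i) *: delta_mx 0 j = 0], whose coordinate [j] is coordinate [i] of
   the total. *)
rewrite big_split /= -scaler_suml => /(congr1 (+%R (\sum_(x : W) x))).
rewrite addKv addvv => /rowP/(_ j); rewrite !mxE !eqxx mulr1 => <-.
by rewrite summxE.
Qed.

Hypothesis HS : direction_system.

Lemma neighbours_direction_graph x :
  neighbours direction_graph x = [set x + v | v in S x].
Proof.
apply/setP=> y; rewrite inE; apply/idP/imsetP => [xy|[v vS ->]].
  by exists (x + y); rewrite ?addKv.
by rewrite /direction_graph addKv.
Qed.

Lemma card_neighbours_direction_graph x : #|neighbours direction_graph x| = d.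
Proof.
case: HS => _ _ cardS _.
by rewrite neighbours_direction_graph card_imset //; apply: addrI.
Qed.

Lemma sum_neighbours_direction_graph x :
  \sum_(y in neighbours direction_graph x) y = x *+ d.+1.
Proof.
case: HS => _ _ cardS sumS; rewrite neighbours_direction_graph big_imset /=.
  by rewrite big_split /= sumr_const cardS sumS -mulrSr.
by move=> u v _ _; apply: addrI.
Qed.

Lemma direction_graph_simple : simple_graph direction_graph.
Proof.
case: HS => symS S0 _ _; split=> [x y|x]; last first.
  by apply/negbTE; rewrite /direction_graph addvv.
rewrite /direction_graph [y + x]addrC.
by apply/idP/idP=> /symS; [rewrite addKv | rewrite [x + y]addrC addKv].
Qed.

Lemma direction_graph_magic : ~~ odd d -> connected_graph direction_graph ->
  closed_xor_magic n direction_graph.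
Proof.
move=> d_even conn; split=> //; first exact: direction_graph_simple.
  by rewrite card_mx card_Fp // mul1n.
exists id; split=> [|x]; first by exists id.
rewrite big_setU1 /=; last by rewrite inE; have [_ ->] := direction_graph_simple.
by rewrite sum_neighbours_direction_graph mulvn_odd /= d_even addvv.
Qed.

Lemma neighbours_direction_cograph x :
  neighbours direction_cograph x = ~: closed_neighbourhood direction_graph x.
Proof. by apply/setP=> y; rewrite !inE negb_or eq_sym. Qed.

Lemma card_closed_direction_graph x :
  #|closed_neighbourhood direction_graph x| = d.+1.
Proof.
rewrite cardsU1 card_neighbours_direction_graph inE.
by have [_ ->] := direction_graph_simple.
Qed.

Lemma direction_cograph_regular : regular_graph (2 ^ n - d.+1) direction_cograph.
Proof.
move=> x; rewrite neighbours_direction_cograph cardsCs setCK.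
by rewrite card_closed_direction_graph card_mx card_Fp // mul1n.
Qed.

Lemma direction_cograph_simple : simple_graph direction_cograph.
Proof.
have [sym _] := direction_graph_simple.
by split=> [x y|x]; rewrite /direction_cograph ?eqxx // eq_sym sym.
Qed.

(** Any two vertices are equal, adjacent or joined through a common neighbour: two closed
    neighbourhoods of size [d.+1] that share two vertices cover at most [d.*2] vertices. *)
Lemma direction_cograph_connected :
  (d.*2 < 2 ^ n)%N -> connected_graph direction_cograph.
Proof.
move=> d_lt x y; have [->|xy] := eqVneq x y; first exact: connect0.
have [cxy|] := boolP (direction_cograph x y); first exact: connect1.
rewrite /direction_cograph xy /= negbK => exy.
have [sym _] := direction_graph_simple; have [csym _] := direction_cograph_simple.
pose B := closed_neighbourhood direction_graph.
(* [B x] and [B y] both contain [x] and [y], so they do not cover the vertices. *)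
have /subsetPn[z _ zB] : ~~ ([set: W] \subset B x :|: B y).
  apply: contraL d_lt => /subset_leq_card; rewrite cardsT card_mx card_Fp // mul1n.
  move=> le; rewrite -leqNgt; apply: leq_trans le _.
  have le2 : (2 <= #|B x :&: B y|)%N.
    suff: [set x; y] \subset B x :&: B y by move/subset_leq_card; rewrite cards2 xy.
    apply/subsetP=> z; rewrite !inE => /orP[]/eqP->.
      by rewrite eqxx sym exy orbT.
    by rewrite eqxx exy orbT.
  rewrite cardsU !card_closed_direction_graph addnn leq_subLR doubleS -add2n.
  by rewrite leq_add2r.
move: zB; rewrite inE negb_or -!in_setC -!neighbours_direction_cograph !inE.
move=> /andP[xz yz]; apply: connect_trans (connect1 xz) (connect1 _).
by rewrite csym.
Qed.

Lemma direction_cograph_magic : odd d -> (1 < n)%N -> (d.*2 < 2 ^ n)%N ->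
  closed_xor_magic n direction_cograph.
Proof.
move=> d_odd n_gt1 d_lt; split.
- exact: direction_cograph_simple.
- exact: direction_cograph_connected.
- by rewrite card_mx card_Fp // mul1n.
exists id; split=> [|x]; first by exists id.
have -> : closed_neighbourhood direction_cograph x = ~: neighbours direction_graph x.
  apply/setP=> y; rewrite !inE eq_sym /direction_cograph.
  by have [->|//] := eqVneq; have [_ ->] := direction_graph_simple.
(* All labels sum to zero, and the neighbours contribute [x *+ d.+1], which is zero for odd [d]. *)
have := sum_row_F2 n_gt1; rewrite (bigID (mem (neighbours direction_graph x))) /=.
rewrite sum_neighbours_direction_graph mulvn_odd /= d_odd add0r => sumC.
by rewrite -[RHS]sumC; apply: eq_bigl => y; rewrite inE.
Qed.

End DirectionSystem.

(** * Vectors over [F_2] as Boolean words, suited to evaluation *)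

Section BitVectors.

Definition xorv (s t : seq bool) : seq bool := [seq p.1 (+) p.2 | p <- zip s t].

Fixpoint words (n : nat) : seq (seq bool) :=
  if n is n'.+1 then [seq b :: s | b <- [:: false; true], s <- words n']
  else [:: [::]].

(* Both are little endian. *)
Fixpoint bits_of_nat (n m : nat) : seq bool :=
  if n is n'.+1 then odd m :: bits_of_nat n' m./2 else [::].

Fixpoint nat_of_bits (s : seq bool) : nat :=
  if s is b :: s' then b + (nat_of_bits s').*2 else 0.

Lemma mem_words n s : size s = n -> s \in words n.
Proof.
move=> <-; elim: s => // b s IHs; apply/allpairsP; exists (b, s); split=> //.
by case: b.
Qed.

Lemma size_xorv s t : size s = size t -> size (xorv s t) = size s.
Proof. by move=> st; rewrite size_map size1_zip // st. Qed.

Lemma nth_xorv s t i : size s = size t ->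
  nth false (xorv s t) i = nth false s i (+) nth false t i.
Proof.
move=> st; have [i_lt|i_ge] := ltnP i (size s).
  by rewrite (nth_map (false, false)) ?nth_zip // size1_zip // st.
by rewrite !nth_default ?size_xorv -?st.
Qed.

Variable n : nat.
Implicit Types (x y : 'rV['F_2]_n) (s t : seq bool).

Definition bits x : seq bool := [seq x ord0 j != 0%R | j <- enum 'I_n].

Definition row_of_bits s : 'rV['F_2]_n := (\row_j (nth false s j)%:R)%R.

Lemma size_bits x : size (bits x) = n.
Proof. by rewrite size_map size_enum_ord. Qed.

Lemma nth_bits x (j : 'I_n) : nth false (bits x) j = (x ord0 j != 0%R).
Proof. by rewrite (nth_map j) ?size_enum_ord // nth_ord_enum. Qed.

Lemma F2_natr (a : 'F_2) : ((a != 0)%:R = a)%R.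
Proof. by apply/val_inj; case: a => [[|[|//]] ?]. Qed.

Lemma bitsK : cancel bits row_of_bits.
Proof. by move=> x; apply/rowP=> j; rewrite mxE nth_bits F2_natr. Qed.

Lemma row_of_bitsK s : size s = n -> bits (row_of_bits s) = s.
Proof.
move=> sn; apply: (@eq_from_nth _ false); rewrite size_bits ?sn // => i i_lt.
by rewrite -[i]/(val (Ordinal i_lt)) nth_bits mxE; case: nth.
Qed.

Lemma row_of_bits_xorv s t : size s = size t ->
  row_of_bits (xorv s t) = (row_of_bits s + row_of_bits t)%R.
Proof.
move=> st; apply/rowP=> j; rewrite !mxE nth_xorv //.
by apply/val_inj; do 2!case: nth.
Qed.

Lemma row_of_bits0 : row_of_bits (nseq n false) = 0%R.
Proof. by apply/rowP=> j; rewrite !mxE nth_nseq if_same. Qed.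

Lemma bits0 : bits 0%R = nseq n false.
Proof. by rewrite -row_of_bits0 row_of_bitsK ?size_nseq. Qed.

Lemma bitsD x y : bits (x + y)%R = xorv (bits x) (bits y).
Proof.
have xy : size (bits x) = size (bits y) by rewrite !size_bits.
rewrite -{1}[x]bitsK -{1}[y]bitsK -row_of_bits_xorv // row_of_bitsK //.
by rewrite size_xorv // size_bits.
Qed.

Lemma row_of_bits_sum ss : all (fun s => size s == n) ss ->
  (\sum_(s <- ss) row_of_bits s)%R = row_of_bits (foldr xorv (nseq n false) ss).
Proof.
have fold_size us : all (fun s => size s == n) us ->
    size (foldr xorv (nseq n false) us) = n.
  elim: us => [_|s us IHus /= /andP[/eqP sn /IHus un]]; first exact: size_nseq.
  by rewrite size_xorv ?sn ?un.
elim: ss => [_|s ss IHss /= /andP[/eqP sn ssn]]; first by rewrite big_nil row_of_bits0.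
by rewrite big_cons IHss // row_of_bits_xorv // sn fold_size.
Qed.

(** * Computable tests for direction systems and connectedness *)

Variable D : seq bool -> seq (seq bool).

(** Decidable form of [direction_system]. The length test makes decoding injective on [D s], so that
    [uniq] and the size of [D s] give the cardinality. *)
Definition is_direction_table (d : nat) : bool :=
  all (fun s => [&& uniq (D s), size (D s) == d, nseq n false \notin D s,
                    all (fun v => (size v == n) && (v \in D (xorv s v))) (D s)
                  & foldr xorv (nseq n false) (D s) == s])
      (words n).

(** For a direction table, iterating this from the zero word lists the balls around zero in the
    graph. *)
Definition reach_step (ss : seq (seq bool)) : seq (seq bool) :=
  undup (ss ++ [seq xorv s v | s <- ss, v <- D s]).

Definition reaches_all (r : nat) : bool :=
  all (fun s => s \in iter r reach_step [:: nseq n false]) (words n).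

Definition directions x : {set 'rV['F_2]_n} := [set v | bits v \in D (bits x)].

Lemma directions_system d : is_direction_table d -> direction_system d directions.
Proof.
move=> /allP tabD.
have {}tabD x := tabD _ (mem_words (size_bits x)).
have sizeD x : all (fun v => size v == n) (D (bits x)).
  by have /and5P[_ _ _ /allP vD _] := tabD x; apply/allP=> v /vD/andP[].
have memD x v : (v \in directions x) = (v \in map row_of_bits (D (bits x))).
  rewrite inE; apply/idP/mapP => [vD|[s sD ->]]; first by exists (bits v); rewrite ?bitsK.
  by rewrite row_of_bitsK //; apply/eqP/(allP (sizeD x)).
have uniqD x : uniq (map row_of_bits (D (bits x))).
  have /and5P[unD _ _ _ _] := tabD x; rewrite map_inj_in_uniq // => s t sD tD.
  move=> /(congr1 bits); rewrite !row_of_bitsK //; apply/eqP.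
    exact: (allP (sizeD x)).
  exact: (allP (sizeD x)).
split=> [x v|x|x|x]; have /and5P[_ /eqP szD nz /allP vD /eqP sumD] := tabD x.
- by rewrite !inE => /vD/andP[_]; rewrite bitsD.
- by rewrite inE bits0.
- by rewrite (eq_card (memD x)) (card_uniqP (uniqD x)) size_map.
rewrite (eq_bigl _ _ (memD x)) -big_uniq //= big_map row_of_bits_sum //.
by rewrite sumD bitsK.
Qed.

Lemma directions_connected d r : is_direction_table d -> reaches_all r ->
  connected_graph (direction_graph directions).
Proof.
move=> tabD /allP reachD.
have [sym _] := direction_graph_simple (directions_system tabD).
have conn0 m s : s \in iter m reach_step [:: nseq n false] ->
    size s = n /\ connect (direction_graph directions) 0%R (row_of_bits s).
  elim: m s => [|m IHm] s /=.
    by rewrite inE => /eqP->; rewrite size_nseq row_of_bits0 connect0.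
  rewrite mem_undup mem_cat => /orP[/IHm//|/allpairsPdep[t [v [/IHm[tn ct] vD ->]]]].
  have vn : size v = n.
    have /and5P[_ _ _ /allP/(_ v vD)/andP[/eqP //]] := allP tabD t (mem_words tn).
  rewrite size_xorv ?tn ?vn //; split=> //; apply: connect_trans ct (connect1 _).
  rewrite /direction_graph row_of_bits_xorv ?tn ?vn // addKv inE.
  by rewrite !row_of_bitsK.
have {}conn0 x : connect (direction_graph directions) 0%R x.
  rewrite -[x]bitsK; apply: proj2 (conn0 r _ (reachD _ _)).
  exact/mem_words/size_bits.
move=> x y; apply: connect_trans (conn0 y).
by rewrite (sym_connect_sym sym).
Qed.

End BitVectors.

(** * Tables and the two operations on them *)

Definition table_directions (T : seq (seq nat)) (s : seq bool) : seq (seq bool) :=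
  map (bits_of_nat (size s)) (nth [::] T (nat_of_bits s)).

Definition add_directions (C : seq nat) (D : seq bool -> seq (seq bool)) s :=
  D s ++ map (bits_of_nat (size s)) C.

(* The three nilpotent matrices map [(a, b)] to [(b, 0)], [(0, a)] and
   [(a + b, a + b)]; each of these images is unchanged by moving along it. *)
Definition lift_directions (p q r : nat) (D : seq bool -> seq (seq bool)) s :=
  if s is a :: b :: t then
    let dir m := bits_of_nat (size t) m in
    [:: b :: false :: dir p, false :: a :: dir q, a (+) b :: a (+) b :: dir r
      & map (cat [:: false; false]) (D t)]
  else [::].

(* Entry [m] of a table [table_n_d] lists the [d] directions at the vertex of
   [F_2 ^ n] coded by [m].  The tables were found by backtracking search, with
   [table_4_6], [table_5_4] and [table_5_5] confined to few directions so that
   unused ones remain for [add_directions] and [lift_directions]. *)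
Definition table_4_4 : seq (seq nat) :=
  [::
     [:: 1; 6; 10; 13]; [:: 1; 2; 5; 7]; [:: 10; 11; 13; 14];
     [:: 2; 6; 10; 13]; [:: 3; 5; 13; 15]; [:: 2; 6; 10; 11];
     [:: 6; 7; 9; 14]; [:: 2; 3; 9; 15]; [:: 3; 10; 14; 15];
     [:: 5; 10; 11; 13]; [:: 1; 6; 7; 10]; [:: 1; 3; 6; 15];
     [:: 1; 5; 6; 14]; [:: 1; 6; 7; 13]; [:: 1; 9; 11; 13];
     [:: 1; 9; 10; 13]].

Definition table_4_5 : seq (seq nat) :=
  [::
     [:: 2; 3; 4; 9; 12]; [:: 4; 5; 6; 9; 15]; [:: 2; 4; 6; 13; 15];
     [:: 3; 4; 6; 13; 15]; [:: 1; 2; 4; 5; 6]; [:: 1; 4; 6; 9; 15];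
     [:: 1; 2; 4; 12; 13]; [:: 1; 4; 6; 9; 13]; [:: 1; 3; 5; 6; 9];
     [:: 1; 2; 5; 6; 9]; [:: 1; 5; 12; 13; 15]; [:: 1; 2; 3; 6; 13];
     [:: 3; 5; 9; 12; 15]; [:: 2; 3; 5; 6; 15]; [:: 3; 6; 9; 13; 15];
     [:: 2; 3; 5; 6; 13]].

Definition table_4_6 : seq (seq nat) :=
  [::
     [:: 4; 5; 8; 10; 13; 14]; [:: 5; 7; 8; 10; 12; 13];
     [:: 5; 7; 8; 11; 13; 14]; [:: 4; 5; 8; 11; 12; 13];
     [:: 4; 5; 8; 9; 11; 15]; [:: 5; 7; 10; 12; 14; 15];
     [:: 5; 7; 11; 12; 13; 14]; [:: 4; 5; 8; 9; 10; 13];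
     [:: 4; 6; 7; 8; 11; 14]; [:: 4; 5; 7; 8; 11; 12];
     [:: 6; 8; 10; 12; 13; 15]; [:: 5; 8; 10; 13; 14; 15];
     [:: 4; 5; 6; 8; 13; 14]; [:: 4; 9; 10; 11; 12; 13];
     [:: 5; 6; 7; 9; 13; 14]; [:: 7; 8; 10; 11; 12; 13]].

Definition table_4_7 : seq (seq nat) :=
  [::
     [:: 1; 2; 6; 8; 12; 14; 15]; [:: 1; 5; 6; 10; 11; 12; 14];
     [:: 2; 4; 7; 9; 11; 12; 13]; [:: 4; 6; 7; 11; 12; 14; 15];
     [:: 2; 5; 7; 9; 12; 14; 15]; [:: 2; 6; 7; 10; 13; 14; 15];
     [:: 2; 4; 6; 8; 10; 11; 15]; [:: 2; 4; 6; 10; 12; 14; 15];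
     [:: 1; 4; 8; 11; 12; 13; 15]; [:: 1; 3; 4; 5; 11; 14; 15];
     [:: 1; 3; 4; 6; 11; 14; 15]; [:: 1; 4; 9; 10; 12; 14; 15];
     [:: 2; 4; 5; 6; 10; 12; 15]; [:: 3; 4; 9; 10; 11; 12; 14];
     [:: 1; 2; 3; 4; 8; 12; 14]; [:: 1; 4; 10; 12; 13; 14; 15]].

Definition table_5_4 : seq (seq nat) :=
  [::
     [:: 2; 8; 21; 31]; [:: 16; 19; 21; 23]; [:: 2; 8; 23; 31];
     [:: 20; 21; 28; 30]; [:: 1; 9; 19; 31]; [:: 1; 2; 27; 29];
     [:: 1; 14; 21; 28]; [:: 1; 2; 19; 23]; [:: 8; 14; 21; 27];
     [:: 3; 7; 19; 30]; [:: 3; 8; 20; 21]; [:: 19; 27; 29; 30];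
     [:: 16; 29; 30; 31]; [:: 3; 9; 19; 20]; [:: 3; 7; 20; 30];
     [:: 23; 27; 29; 30]; [:: 2; 23; 27; 30]; [:: 2; 16; 29; 30];
     [:: 2; 19; 29; 30]; [:: 2; 21; 27; 31]; [:: 9; 19; 21; 27];
     [:: 9; 21; 23; 30]; [:: 9; 21; 23; 29]; [:: 14; 19; 20; 30];
     [:: 1; 19; 23; 29]; [:: 1; 2; 14; 20]; [:: 1; 19; 20; 28];
     [:: 1; 2; 7; 31]; [:: 2; 7; 9; 16]; [:: 9; 21; 30; 31];
     [:: 2; 19; 20; 27]; [:: 9; 21; 28; 31]].

Definition table_5_5 : seq (seq nat) :=
  [::
     [:: 1; 3; 15; 16; 29]; [:: 1; 7; 8; 16; 31]; [:: 15; 17; 20; 23; 31];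
     [:: 3; 7; 15; 23; 31]; [:: 7; 8; 15; 27; 31];
     [:: 13; 16; 20; 23; 27]; [:: 1; 7; 13; 22; 27];
     [:: 1; 8; 13; 20; 23]; [:: 13; 16; 23; 29; 31]; [:: 2; 7; 8; 27; 31];
     [:: 13; 16; 22; 28; 29]; [:: 2; 13; 15; 23; 28];
     [:: 3; 8; 15; 20; 28]; [:: 15; 20; 23; 28; 29];
     [:: 7; 16; 17; 20; 28]; [:: 3; 8; 15; 23; 28];
     [:: 16; 22; 23; 28; 29]; [:: 5; 12; 16; 20; 28];
     [:: 5; 7; 23; 27; 28]; [:: 7; 13; 17; 20; 28]; [:: 5; 7; 12; 13; 23];
     [:: 7; 8; 16; 23; 29]; [:: 12; 13; 20; 28; 31];
     [:: 5; 12; 28; 29; 31]; [:: 7; 12; 16; 20; 23]; [:: 2; 5; 7; 13; 20];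
     [:: 5; 12; 16; 20; 23]; [:: 2; 7; 12; 13; 31]; [:: 5; 7; 22; 23; 31];
     [:: 8; 12; 27; 29; 31]; [:: 7; 13; 16; 27; 31]; [:: 5; 7; 17; 23; 27]].

Definition table_5_7 : seq (seq nat) :=
  [::
     [:: 2; 6; 11; 12; 15; 17; 29]; [:: 4; 6; 12; 17; 24; 27; 29];
     [:: 1; 2; 7; 8; 12; 24; 26]; [:: 1; 6; 7; 8; 12; 26; 29];
     [:: 2; 7; 8; 12; 15; 17; 27]; [:: 4; 6; 7; 11; 12; 26; 29];
     [:: 2; 6; 11; 12; 15; 17; 27]; [:: 6; 8; 11; 12; 15; 26; 27];
     [:: 6; 12; 15; 17; 26; 27; 29]; [:: 6; 12; 15; 17; 24; 26; 31];
     [:: 4; 6; 7; 8; 12; 17; 26]; [:: 7; 8; 11; 12; 15; 17; 29];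
     [:: 6; 7; 8; 11; 12; 29; 31]; [:: 7; 11; 12; 17; 26; 27; 29];
     [:: 1; 4; 6; 11; 12; 17; 27]; [:: 1; 6; 8; 12; 15; 24; 27];
     [:: 4; 5; 11; 12; 17; 26; 29]; [:: 2; 4; 12; 15; 17; 24; 29];
     [:: 1; 4; 6; 8; 12; 15; 26]; [:: 1; 2; 5; 11; 26; 27; 31];
     [:: 1; 4; 6; 8; 11; 15; 27]; [:: 1; 2; 4; 5; 17; 27; 29];
     [:: 1; 4; 5; 15; 27; 29; 31]; [:: 1; 2; 11; 12; 17; 24; 26];
     [:: 4; 6; 7; 11; 17; 26; 29]; [:: 4; 6; 7; 15; 17; 24; 26];
     [:: 1; 4; 5; 8; 17; 24; 27]; [:: 1; 5; 6; 11; 12; 15; 17];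
     [:: 4; 8; 11; 12; 17; 27; 29]; [:: 4; 6; 12; 15; 26; 27; 29];
     [:: 4; 5; 6; 7; 12; 15; 29]; [:: 5; 6; 7; 11; 17; 26; 27]].

(** * The graphs for each pair of parameters *)

Definition magic_regular_graph_exists (n k : nat) : Prop :=
  exists (V : finType) (e : rel V), closed_xor_magic n e /\ regular_graph k e.

Lemma even_direction_table (n k r : nat) D : is_direction_table n D k ->
  reaches_all n D r -> ~~ odd k -> magic_regular_graph_exists n k.
Proof.
move=> tabD reachD k_even; have sysD := directions_system tabD.
exists 'rV['F_2]_n, (direction_graph (directions D)); split.
  exact: direction_graph_magic sysD k_even (directions_connected tabD reachD).
exact: card_neighbours_direction_graph sysD.
Qed.

(** The complement is taken; its connectedness comes from counting rather than from a search. *)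
Lemma odd_direction_table (n k d : nat) D : is_direction_table n D d ->
  [&& odd d, 1 < n, d.*2 < 2 ^ n & k == 2 ^ n - d.+1] ->
  magic_regular_graph_exists n k.
Proof.
move=> tabD /and4P[d_odd n_gt1 d_lt /eqP->]; have sysD := directions_system tabD.
exists 'rV['F_2]_n, (direction_cograph (directions D)); split.
  exact: direction_cograph_magic sysD d_odd n_gt1 d_lt.
exact: direction_cograph_regular sysD.
Qed.

Lemma magic_regular_4_4 : magic_regular_graph_exists 4 4.
Proof.
(* The [6] is a number of steps within which every vertex is reached from zero. *)
by apply: (@even_direction_table _ _ 6 (table_directions table_4_4)); vm_compute.
Qed.

Lemma magic_regular_4_6 : magic_regular_graph_exists 4 6.
Proof.
by apply: (@even_direction_table _ _ 6 (table_directions table_4_6)); vm_compute.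
Qed.

Lemma magic_regular_4_8 : magic_regular_graph_exists 4 8.
Proof.
by apply: (@odd_direction_table _ _ 7 (table_directions table_4_7)); vm_compute.
Qed.

Lemma magic_regular_4_10 : magic_regular_graph_exists 4 10.
Proof.
by apply: (@odd_direction_table _ _ 5 (table_directions table_4_5)); vm_compute.
Qed.

Lemma magic_regular_5_4 : magic_regular_graph_exists 5 4.
Proof.
by apply: (@even_direction_table _ _ 6 (table_directions table_5_4)); vm_compute.
Qed.

Lemma magic_regular_5_16 : magic_regular_graph_exists 5 16.
Proof.
(* [table_5_5] avoids thirteen nonzero directions; ten of them with sum zero raise [d] from 5 to 15,
   and 32 - 16 = 16. *)
by apply: (@odd_direction_table _ _ 15
   (add_directions [:: 4; 6; 9; 10; 11; 14; 18; 21; 25; 26]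
      (table_directions table_5_5))); vm_compute.
Qed.

Lemma magic_regular_5_18 : magic_regular_graph_exists 5 18.
Proof.
by apply: (@odd_direction_table _ _ 13
   (add_directions [:: 4; 6; 9; 10; 11; 14; 26; 30]
      (table_directions table_5_5))); vm_compute.
Qed.

Lemma magic_regular_5_20 : magic_regular_graph_exists 5 20.
Proof.
by apply: (@odd_direction_table _ _ 11
   (add_directions [:: 4; 6; 9; 10; 18; 19]
      (table_directions table_5_5))); vm_compute.
Qed.

Lemma magic_regular_5_22 : magic_regular_graph_exists 5 22.
Proof.
by apply: (@odd_direction_table _ _ 9
   (add_directions [:: 4; 6; 9; 11]
      (table_directions table_5_5))); vm_compute.
Qed.

(** Here [d] is 7. Two distinct directions never sum to zero, so [add_directions] cannot get from 5
    to 7 and a separate table is used. *)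
Lemma magic_regular_5_24 : magic_regular_graph_exists 5 24.
Proof.
by apply: (@odd_direction_table _ _ 7 (table_directions table_5_7)); vm_compute.
Qed.

Lemma magic_regular_5_26 : magic_regular_graph_exists 5 26.
Proof.
by apply: (@odd_direction_table _ _ 5 (table_directions table_5_5)); vm_compute.
Qed.

Lemma magic_regular_6_54 : magic_regular_graph_exists 6 54.
Proof.
by apply: (@odd_direction_table _ _ 9
   (lift_directions 1 2 3
      (table_directions table_4_6))); vm_compute.
Qed.

Lemma magic_regular_7_114 : magic_regular_graph_exists 7 114.
Proof.
(* Both 5, 10, 15 and the six added codes have sum zero and avoid [table_5_4] and each other, so [d]
   is 4 + 6 + 3 and the degree is 128 - 14. *)
by apply: (@odd_direction_table _ _ 13
   (lift_directions 5 10 15 (add_directions [:: 4; 6; 17; 18; 24; 25]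
      (table_directions table_5_4)))); vm_compute.
Qed.

Theorem theorem6 (n k : nat)
  (hnk : (n = 4 /\ k \in [:: 4; 6; 8; 10])
      \/ (n = 5 /\ k \in [:: 4; 16; 18; 20; 22; 24; 26])
      \/ (n = 6 /\ k = 54)
      \/ (n = 7 /\ k = 114)) :
  exists (V : finType) (e : rel V),
    closed_xor_magic n e /\ regular_graph k e.
Proof.
rewrite -/(magic_regular_graph_exists n k).
case: hnk => [[->]|[[->]|[[-> ->]|[-> ->]]]].
- rewrite !inE => /or4P[]/eqP->.
  + exact: magic_regular_4_4.
  + exact: magic_regular_4_6.
  + exact: magic_regular_4_8.
  + exact: magic_regular_4_10.
- rewrite !inE => /or4P[/eqP->|/eqP->|/eqP->|/or4P[]/eqP->].
  + exact: magic_regular_5_4.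
  + exact: magic_regular_5_16.
  + exact: magic_regular_5_18.
  + exact: magic_regular_5_20.
  + exact: magic_regular_5_22.
  + exact: magic_regular_5_24.
  + exact: magic_regular_5_26.
- exact: magic_regular_6_54.
- exact: magic_regular_7_114.
Qed.
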